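(* There is a universal constant $c>0$ such that for every $n\ge 2$ and every weight function $w$ on $\{1,\dots,n\}$, as operators on $L^2(S_n)$, $$\Delta_w\ \ge\ \frac{c\,\delta}{\operatorname{dmix} w}\cdot\frac{\min_i w_i^2}{w_{\mathrm{tot}}}\ \Delta_{K_n},$$ where $\delta$ is given by $$\frac1\delta=\prod_{k=0}^{\lfloor\log_2 \operatorname{dmix} w\rfloor}\max_i\bigl(1+p_{2^k}(i,i)\bigr).$$
   Context: A weight function $w$ on $\{1,\dots,n\}$ assigns to each unordered pair $\{i,j\}$, $i\neq j$, a number $w_{ij}=w_{ji}\in[0,\infty)$. Put $w_i=\sum_{j\ne i}w_{ij}$ and $w_{\mathrm{tot}}=\sum_i w_i$; it is assumed that $w_i>0$ for all $i$. An element $A=\sum_\sigma c_\sigma\sigma$ of the group algebra of the symmetric group $S_n$ over $\mathbb C$ acts on $L^2(S_n)$ by $(Af)(\tau)=\sum_\sigma c_\sigma f(\sigma\tau)$. For $i\ne j$ let $\nabla_{ij}=1-(ij)$, where $(ij)$ is the transposition, and let $\Delta_w=\sum_{i<j}w_{ij}\nabla_{ij}$ and $\Delta_{K_n}=\sum_{i<j}\nabla_{ij}$. For self-adjoint operators, $A\ge B$ means that $A-B$ is positive semidefinite. Let $p_t(i,j)$, $t=0,1,2,\dots$, be the $t$-step transition probabilities of the lazy discrete-time Markov chain on $\{1,\dots,n\}$ with one-step probabilities $p(i,j)=\frac{w_{ij}}{2w_i}$ for $i\neq j$ and $p(i,i)=\frac12$. Let $\pi(j)=w_j/w_{\mathrm{tot}}$.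 Define $$\operatorname{dmix} w=\min\{t:\ \forall i,j,\ p_t(i,j)>\tfrac34\pi(j)\},$$ with value $\infty$ if no such $t$ exists (this happens exactly when $w$ is disconnected); in that case the coefficient of $\Delta_{K_n}$ in the inequality is read as $0$. *)

(* Defs.v *)
From mathcomp Require Export all_boot all_order all_algebra all_fingroup.
From mathcomp Require Export boolp reals complex.

Set Implicit Arguments.
Unset Strict Implicit.
Unset Printing Implicit Defensive.

Import Order.TTheory GRing.Theory Num.Theory.

Local Open Scope ring_scope.
Local Open Scope complex_scope.

(** * Weights and the lazy random walk *)

Section Weights.
Variables (R : realType) (n : nat) (w : 'I_n -> 'I_n -> R).

Definition wdeg (i : 'I_n) : R := \sum_(j < n | j != i) w i j.

Definition wtot : R := \sum_(i < n) wdeg i.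

(* The diagonal values w i i are irrelevant: no definition below reads them. *)
Definition weight_function : Prop :=
  [/\ forall i j, i != j -> w i j = w j i,
      forall i j, i != j -> 0 <= w i j
    & forall i, 0 < wdeg i].

Definition lazy_walk : 'M[R]_n :=
  \matrix_(i, j) (if i == j then 2^-1 else w i j / (2 * wdeg i)).

Definition trans_prob (t : nat) (i j : 'I_n) : R := (lazy_walk ^+ t) i j.

Definition stationary (j : 'I_n) : R := wdeg j / wtot.

Definition mixed (t : nat) : bool :=
  [forall i : 'I_n, forall j : 'I_n,
     3 / 4 * stationary j < trans_prob t i j].

(* [None] stands for the value infinity. *)
Definition dmix : option nat :=
  match pselect (exists t, mixed t) with
  | left ex_t => Some (ex_minn ex_t)
  | right _ => None
  end.

(* Every 1 + p_t(i,i) is at least 1, so for n > 0 the default value 0 of the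
   iterated maximum does not matter. *)
Definition max_return (t : nat) : R :=
  \big[Num.max/0]_(i < n) (1 + trans_prob t i i).

Definition delta (d : nat) : R :=
  (\prod_(0 <= k < (trunc_log 2 d).+1) max_return (2 ^ k))^-1.

(* For a weight function w_i <= w_tot for all i, so for n > 0 the default value
   w_tot ^ 2 of the iterated minimum does not matter. *)
Definition min_wdeg_sq : R := \big[Num.min/wtot ^+ 2]_(i < n) wdeg i ^+ 2.

Definition mix_coef (c : R) : R :=
  match dmix with
  | Some d => c * delta d / d%:R * (min_wdeg_sq / wtot)
  | None => 0
  end.

End Weights.

(** * The group algebra of S_n and its action on L^2(S_n) *)

Section GroupAlgebra.
Variables (R : realType) (n : nat).

(* The group algebra is used only as a vector space: the pointwise product that
   MathComp puts on finite functions is not its product. *)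
Local Notation group_algebra := {ffun 'S_n -> R[i]}.
Local Notation L2 := {ffun 'S_n -> R[i]}.

Definition galg_of (s : 'S_n) : group_algebra := [ffun t => (t == s)%:R].

(* The product sigma tau in S_n is the composition x |-> sigma (tau x), which is
   [tau * sigma] with MathComp's product of permutations. *)
Definition gact (A : group_algebra) (f : L2) : L2 :=
  [ffun tau : 'S_n => \sum_(sigma : 'S_n) A sigma * f (tau * sigma)%g].

Definition nabla (i j : 'I_n) : group_algebra :=
  galg_of 1%g - galg_of (tperm i j).

Definition Delta (w : 'I_n -> 'I_n -> R) : group_algebra :=
  \sum_(i < n) \sum_(j < n | (i < j)%N) (w i j)%:C *: nabla i j.

Definition DeltaK : group_algebra :=
  \sum_(i < n) \sum_(j < n | (i < j)%N) nabla i j.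

Definition L2_dot (f g : L2) : R[i] :=
  \sum_(tau : 'S_n) f tau * Num.conj (g tau).

(* In R[i], [0 <= z] says that z is real and nonnegative. *)
Definition psd (T : L2 -> L2) : Prop := forall f : L2, 0 <= L2_dot (T f) f.

Definition op_ge (S T : L2 -> L2) : Prop := psd (fun f => S f - T f).

End GroupAlgebra.

Arguments DeltaK {R n}.

(* Main.v *)
(* Fix a real function f on S_n, put corr s = sum_t f(t) f(ts) and
   E(i,j) = corr 1 - corr (ij) >= 0. The octopus inequality says
   sum_ij c_i c_j corr (ij) >= 0 whenever sum c = 0 and at most one c_i is negative.
   With c = p_t(i,.) - 1_i and reversibility it gives
   sum_jk w_j p_2t(j,k) E(j,k) <= 2 sum_jk w_j p_t(j,k) E(j,k).
   Iterating from t = 1 to a power of two in (dmix, 2 dmix], where p_t > 3/4 pi, gives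
   the theorem with c = 3/4, and even without the factor delta <= 1.

   For the octopus inequality, let F = sum_ij c_i c_j (ij) (with (ii) = 1) and
   N = sum c_i^2. As sum c = 0, 12 N F = 6 F^2 - sum_ijkl c_i c_j c_k c_l Q_ijkl, where
   Q_J, for a set J of four points, is 12 times the projection of the group algebra of
   S_J onto its isotypic component (2,2), and Q = 0 for coinciding indices. Again by
   sum c = 0 one may replace Q_ijkl by Q_ijkl - Q_oijk - Q_oijl - Q_oikl - Q_ojkl, which
   vanishes if o is among i,j,k,l and is nonpositive otherwise: on five points, the sum
   of four of the Q_J minus the fifth is 24 times a projection. *)

Require Import Defs.
From mathcomp Require Import ring lra.
Set Implicit Arguments.
Unset Strict Implicit.
Unset Printing Implicit Defensive.
Import Order.TTheory GRing.Theory Num.Theory.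
Local Open Scope ring_scope.

(** * Group algebra elements supported on few points *)

(** Letters are indices that a map [x] sends to points. Identities in the group algebras of S_4 and
    S_5 can thus be decided by computation on natural numbers and then transported to any
    [{perm T}]. *)
Definition word := seq (nat * nat).

Definition swapn (p : nat * nat) (i : nat) : nat :=
  if i == p.1 then p.2 else if i == p.2 then p.1 else i.

(** The leftmost letter acts first, in agreement with MathComp's product of permutations. *)
Definition word_act (w : word) (i : nat) : nat := foldl (fun j p => swapn p j) i w.

Definition word_key (m : nat) (w : word) : seq nat := map (word_act w) (iota 0 m).

Definition word_le (m : nat) (w : word) : bool :=
  all (fun p => (p.1 < m)%N && (p.2 < m)%N) w.

Section Words.
Variables (T : finType) (x : nat -> T) (m : nat).
Hypothesis x_inj : {in gtn m &, injective x}.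

Definition word_perm (w : word) : {perm T} :=
  (\prod_(p <- w) tperm (x p.1) (x p.2))%g.

Lemma word_perm_cons p w :
  word_perm (p :: w) = (tperm (x p.1) (x p.2) * word_perm w)%g.
Proof. by rewrite /word_perm big_cons. Qed.

Lemma word_perm_cat w1 w2 :
  word_perm (w1 ++ w2) = (word_perm w1 * word_perm w2)%g.
Proof. by rewrite /word_perm big_cat. Qed.

Lemma word_permV w : (word_perm w)^-1%g = word_perm (rev w).
Proof.
elim: w => [|p w IHw]; first by rewrite /word_perm big_nil invg1.
rewrite rev_cons -cats1 word_perm_cat word_perm_cons invMg IHw tpermV.
by rewrite word_perm_cons /word_perm big_nil mulg1.
Qed.

Lemma word_perm_act w i : word_le m w -> (i < m)%N ->
  word_perm w (x i) = x (word_act w i) /\ (word_act w i < m)%N.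
Proof.
elim: w i => [|p w IHw] i /=; first by rewrite /word_perm big_nil perm1.
case/andP=> /andP[p1 p2] wm im.
have sm : (swapn p i < m)%N by rewrite /swapn; case: ifP => // _; case: ifP.
have [<- ?] := IHw _ wm sm; split=> //.
rewrite word_perm_cons permM; congr (word_perm w _).
rewrite /swapn; case: eqP => [->|/eqP i1]; first by rewrite tpermL.
case: eqP => [->|/eqP i2]; first by rewrite tpermR.
by rewrite tpermD ?(inj_in_eq x_inj) // eq_sym.
Qed.

Lemma word_perm_out w y : word_le m w -> y \notin map x (iota 0 m) ->
  word_perm w y = y.
Proof.
move=> + yP; elim: w => [|p w IHw] /=; first by rewrite /word_perm big_nil perm1.
case/andP=> /andP[p1 p2] wm; rewrite word_perm_cons permM tpermD ?IHw //.
  by apply: contraNneq yP => <-; apply: map_f; rewrite mem_iota.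
by apply: contraNneq yP => <-; apply: map_f; rewrite mem_iota.
Qed.

(** Both products fix every point that is not some x i with i < m, so the table of images of these
    indices decides equality. *)
Lemma word_perm_eq w1 w2 : word_le m w1 -> word_le m w2 ->
  word_key m w1 = word_key m w2 -> word_perm w1 = word_perm w2.
Proof.
move=> m1 m2 /eq_in_map e; apply/permP => y.
have [/mapP[i im ->]|yP] := boolP (y \in map x (iota 0 m)); last by rewrite !word_perm_out.
move: (e i im); rewrite mem_iota /= in im.
by rewrite !(word_perm_act _ im).1 // => ->.
Qed.

End Words.

(* A formal integral combination of words. *)
Definition formal := seq (int * word).

Definition formal_mul (L1 L2 : formal) : formal :=
  [seq (a.1 * b.1, a.2 ++ b.2) | a <- L1, b <- L2].

Definition formal_scale (k : int) (L : formal) : formal :=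
  [seq (k * a.1, a.2) | a <- L].

Definition formal_adj (L : formal) : formal := [seq (a.1, rev a.2) | a <- L].

Definition formal_le (m : nat) (L : formal) := all (fun a => word_le m a.2) L.

Definition key_sum (k : seq nat) (K : seq (int * seq nat)) : int :=
  foldr (fun a s => if a.2 == k then a.1 + s else s) 0 K.

Definition formal_null (m : nat) (L : formal) : bool :=
  let K := [seq (a.1, word_key m a.2) | a <- L] in
  all (fun k => key_sum k K == 0) (undup (unzip2 K)).

(* The element 2 (1 + double transpositions) - (3-cycles) of the group algebra of S_4. *)
Definition four_form (a b c d : nat) : formal :=
  [:: (2 : int, [::]); (2 : int, [:: (a, b); (c, d)]); (2 : int, [:: (a, c); (b, d)]);
      (2 : int, [:: (a, d); (b, c)]);
      (-1, [:: (a, b); (b, c)]); (-1, [:: (b, c); (a, b)]);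
      (-1, [:: (a, b); (b, d)]); (-1, [:: (b, d); (a, b)]);
      (-1, [:: (a, c); (c, d)]); (-1, [:: (c, d); (a, c)]);
      (-1, [:: (b, c); (c, d)]); (-1, [:: (c, d); (b, c)])].

Definition five_form : formal :=
  four_form 4 0 1 2 ++ four_form 4 0 1 3 ++ four_form 4 0 2 3 ++ four_form 4 1 2 3
  ++ formal_scale (-1) (four_form 0 1 2 3).

(* L^* L = k L, so that L = L^* L / k is positive semidefinite when 0 < k. *)
Definition almost_proj (m : nat) (k : int) (L : formal) : bool :=
  formal_le m L && formal_null m (formal_mul (formal_adj L) L ++ formal_scale (- k) L).

(** The irreducible character of (2,2) has degree 2 and takes the values 2, 2, -1 on the identity,
    the double transpositions and the 3-cycles, and 0 elsewhere. The form is therefore 4!/2 = 12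
    times a central idempotent. *)
Lemma four_form_proj : almost_proj 4 12 (four_form 0 1 2 3).
Proof. by vm_compute. Qed.

Lemma five_form_proj : almost_proj 5 24 five_form.
Proof. by vm_compute. Qed.

(** * The octopus inequality *)

Section Correlation.
Variables (R : realFieldType) (T : finType) (f : {perm T} -> R).

Definition corr (s : {perm T}) : R := \sum_t f t * f (t * s)%g.

Lemma corrV s : corr s^-1%g = corr s.
Proof.
rewrite /corr (reindex_inj (mulIg s)) /=; apply: eq_bigr => t _.
by rewrite mulgK mulrC.
Qed.

(** Extended linearly, [corr] takes at A^* A the value of the squared norm of A f; this is the only
    source of positivity below. *)
Lemma corr_sqr (I : Type) (r : seq I) (a : I -> R) (s : I -> {perm T}) :
  \sum_t (\sum_(i <- r) a i * f (t * s i)%g) ^+ 2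
  = \sum_(i <- r) \sum_(j <- r) a i * a j * corr ((s i)^-1 * s j)%g.
Proof.
under eq_bigr do rewrite expr2 mulr_suml.
rewrite exchange_big /=; apply: eq_bigr => i _.
under eq_bigr do rewrite mulr_sumr.
rewrite exchange_big /=; apply: eq_bigr => j _.
rewrite /corr mulr_sumr [RHS](reindex_inj (mulIg (s i))) /=.
by apply: eq_bigr => t _; rewrite mulgA mulgK; ring.
Qed.

Section FormalCorr.
Variable x : nat -> T.

Definition formal_corr (L : formal) : R :=
  \sum_(a <- L) a.1%:~R * corr (word_perm x a.2).

Lemma formal_corr_cat L1 L2 :
  formal_corr (L1 ++ L2) = formal_corr L1 + formal_corr L2.
Proof. by rewrite /formal_corr big_cat. Qed.

Lemma formal_corr_scale k L : formal_corr (formal_scale k L) = k%:~R * formal_corr L.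
Proof.
rewrite /formal_corr big_map mulr_sumr; apply: eq_bigr => a _ /=.
by rewrite intrM mulrA.
Qed.

Lemma formal_corr_adj_mul L :
  formal_corr (formal_mul (formal_adj L) L)
  = \sum_t (\sum_(a <- L) a.1%:~R * f (t * word_perm x a.2)%g) ^+ 2.
Proof.
rewrite corr_sqr /formal_corr big_allpairs_dep big_map /=.
apply: eq_bigr => a _; apply: eq_bigr => b _ /=.
by rewrite word_perm_cat -word_permV intrM.
Qed.

Variable m : nat.
Hypothesis x_inj : {in gtn m &, injective x}.

Lemma key_sumE k (L : formal) :
  key_sum k [seq (a.1, word_key m a.2) | a <- L]
  = \sum_(a <- L | word_key m a.2 == k) a.1.
Proof.
by elim: L => [|a L IHL] /=; rewrite ?big_nil // big_cons IHL.
Qed.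

Lemma formal_corr_null L : formal_le m L -> formal_null m L -> formal_corr L = 0.
Proof.
rewrite /formal_null => lem /allP nul; rewrite /formal_corr.
set K := undup _ in nul.
have memK a : a \in L -> word_key m a.2 \in K.
  move=> aL; rewrite mem_undup.
  exact: (map_f snd (map_f (fun b : int * word => (b.1, word_key m b.2)) aL)).
(* Group the terms by the permutation they represent: [corr] is constant on each group, and the
   coefficients in a group add up to 0. *)
have -> : \sum_(a <- L) a.1%:~R * corr (word_perm x a.2)
  = \sum_(k <- K) \sum_(a <- L | word_key m a.2 == k)
       a.1%:~R * corr (word_perm x a.2).
  rewrite (exchange_big_dep predT) //= big_seq [RHS]big_seq; apply: eq_bigr => a aL.
  under eq_bigl do rewrite eq_sym.
  by rewrite -big_filter filter_pred1_uniq ?undup_uniq ?memK // big_seq1.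
rewrite big_seq big1 // => k /nul; rewrite key_sumE => /eqP sum0.
have [/hasP[b bL /eqP kb]|/hasPn none] := boolP (has (fun a => word_key m a.2 == k) L).
  transitivity ((\sum_(a <- L | word_key m a.2 == k) a.1)%:~R * corr (word_perm x b.2)).
    rewrite rmorph_sum mulr_suml big_seq_cond [RHS]big_seq_cond.
    apply: eq_bigr => a /andP[aL /eqP ka]; congr (_ * corr _).
    by apply: (word_perm_eq x_inj); rewrite ?(allP lem) // ka kb.
  by rewrite sum0 mul0r.
by rewrite big_seq_cond big1 // => a /andP[/none/negPf ->].
Qed.

Lemma formal_corr_ge0 (k : int) L : 0 < k -> almost_proj m k L -> 0 <= formal_corr L.
Proof.
move=> k_gt0 /andP[lem nul].
have lemul : formal_le m (formal_mul (formal_adj L) L ++ formal_scale (- k) L).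
  rewrite /formal_le all_cat !all_map; apply/andP; split; last first.
    by apply: sub_all lem => a.
  apply/allP=> _ /allpairsP[[a b] /= [/mapP[c cL ->] bL ->]] /=.
  by rewrite /word_le all_cat all_rev; apply/andP; split; apply: (allP lem).
have := formal_corr_null lemul nul.
rewrite formal_corr_cat formal_corr_adj_mul formal_corr_scale intrN mulNr.
move/eqP; rewrite subr_eq0 => /eqP sqE.
rewrite -(pmulr_rge0 _ (_ : 0 < k%:~R)) ?ltr0z // -sqE.
by apply: sumr_ge0 => t _; apply: sqr_ge0.
Qed.

End FormalCorr.

(* Since corr s^-1 = corr s, [dtr i j j k] is a symmetric function of distinct i, j, k. *)
Definition dtr i j k l := corr (tperm i j * tperm k l)%g.

Lemma dtrCl i j k l : dtr i j k l = dtr j i k l.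
Proof. by rewrite /dtr tpermC. Qed.

Lemma dtrCr i j k l : dtr i j k l = dtr i j l k.
Proof. by rewrite /dtr [tperm k l]tpermC. Qed.

Lemma dtrC i j k l : dtr i j k l = dtr k l i j.
Proof. by rewrite /dtr -corrV invMg !tpermV. Qed.

Lemma dtr1 i k l : dtr i i k l = corr (tperm k l).
Proof. by rewrite /dtr tperm1 mul1g. Qed.

Lemma dtr2 i j : dtr i j i j = corr 1%g.
Proof. by rewrite /dtr tperm2. Qed.

(** Both products are the same 3-cycle: conjugating (ij) by (jk) gives (ik). *)
Lemma dtr_rot i j k : i != j -> i != k -> j != k -> dtr i j j k = dtr j k k i.
Proof.
move=> ij ik jk; rewrite /dtr; congr corr.
by rewrite conjgC tpermJ tpermL tpermD 1?eq_sym // [tperm i k]tpermC.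
Qed.

(** The value of [corr] at Q_ijkl. The eight 3-cycles form four pairs of inverses, one for each
    three of the points, whence the four [dtr] terms with coefficient -2. *)
Definition four (i j k l : T) : R :=
  if uniq [:: i; j; k; l] then
    2 * corr 1%g + 2 * (dtr i j k l + dtr i k j l + dtr i l j k)
    - 2 * (dtr i j j k + dtr i j j l + dtr i k k l + dtr j k k l)
  else 0.

Lemma formal_four (x : nat -> T) a b c d : uniq [:: x a; x b; x c; x d] ->
  formal_corr x (four_form a b c d) = four (x a) (x b) (x c) (x d).
Proof.
move=> u; rewrite /four u /formal_corr !big_cons big_nil /word_perm !big_cons !big_nil /=.
rewrite !mulg1 -!/(dtr _ _ _ _).
rewrite (dtrC (x b) (x c) (x a) (x b)) (dtrC (x b) (x d) (x a) (x b)).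
rewrite (dtrC (x c) (x d) (x a) (x c)) (dtrC (x c) (x d) (x b) (x c)).
ring.
Qed.

Lemma nth_uniq_inj (x0 : T) (s : seq T) : uniq s -> {in gtn (size s) &, injective (nth x0 s)}.
Proof. by move=> us a b al bl /eqP; rewrite nth_uniq // => /eqP. Qed.

Lemma four_ge0 i j k l : 0 <= four i j k l.
Proof.
case u: (uniq [:: i; j; k; l]); last by rewrite /four u.
have /= <- := @formal_four (nth i [:: i; j; k; l]) 0 1 2 3 u.
exact: (formal_corr_ge0 (nth_uniq_inj u) (_ : 0 < 12) four_form_proj).
Qed.

Lemma five_ge0 o i j k l : uniq [:: i; j; k; l; o] ->
  four i j k l <= four o i j k + four o i j l + four o i k l + four o j k l.
Proof.
move=> u.
have := formal_corr_ge0 (nth_uniq_inj (x0 := i) u) (_ : 0 < 24) five_form_proj.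
rewrite /five_form !formal_corr_cat formal_corr_scale.
move: u; rewrite /= !inE !negb_or -!andbA.
case/and5P=> ij ik il io /and5P[jk jl jo kl /and3P[ko lo _]].
rewrite !formal_four /= ?inE ?negb_or -?andbA ?(eq_sym o) ?ij ?ik ?il ?io ?jk ?jl ?jo ?kl ?ko ?lo //.
by move=> /(_ isT); lra.
Qed.

End Correlation.

(** * Quartic forms with coefficients of sum zero *)

Section Quartic.
Variables (R : realFieldType) (T : finType) (c : T -> R).

Definition quartic (g : T -> T -> T -> T -> R) : R :=
  \sum_i \sum_j \sum_k \sum_l c i * c j * c k * c l * g i j k l.

Lemma eq_quartic g h : (forall i j k l, g i j k l = h i j k l) -> quartic g = quartic h.
Proof.
move=> e; apply: eq_bigr => i _; apply: eq_bigr => j _; apply: eq_bigr => k _.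
by apply: eq_bigr => l _; rewrite e.
Qed.

Lemma quarticD g h :
  quartic (fun i j k l => g i j k l + h i j k l) = quartic g + quartic h.
Proof.
rewrite /quartic -big_split; apply: eq_bigr => i _ /=.
rewrite -big_split; apply: eq_bigr => j _ /=.
rewrite -big_split; apply: eq_bigr => k _ /=.
by rewrite -big_split; apply: eq_bigr => l _ /=; rewrite mulrDr.
Qed.

Lemma quarticZ a g : quartic (fun i j k l => a * g i j k l) = a * quartic g.
Proof.
rewrite /quartic mulr_sumr; apply: eq_bigr => i _ /=.
rewrite mulr_sumr; apply: eq_bigr => j _ /=.
rewrite mulr_sumr; apply: eq_bigr => k _ /=.
by rewrite mulr_sumr; apply: eq_bigr => l _ /=; rewrite mulrCA.
Qed.

Lemma quarticC12 g : quartic (fun i j k l => g j i k l) = quartic g.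
Proof.
rewrite /quartic exchange_big; apply: eq_bigr => i _; apply: eq_bigr => j _.
by apply: eq_bigr => k _; apply: eq_bigr => l _; rewrite [c j * _]mulrC.
Qed.

Lemma quarticC23 g : quartic (fun i j k l => g i k j l) = quartic g.
Proof.
apply: eq_bigr => i _; rewrite exchange_big; apply: eq_bigr => j _.
by apply: eq_bigr => k _; apply: eq_bigr => l _; rewrite [c i * _ * _]mulrAC.
Qed.

Lemma quarticC34 g : quartic (fun i j k l => g i j l k) = quartic g.
Proof.
apply: eq_bigr => i _; apply: eq_bigr => j _; rewrite exchange_big.
by apply: eq_bigr => k _; apply: eq_bigr => l _; rewrite [_ * c l * c k]mulrAC.
Qed.

Hypothesis sum_c : \sum_i c i = 0.

(** Summing first over the missing index gives a factor sum c = 0. This and its three variants allow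
    any function of three of the indices to be added under [quartic]. *)
Lemma quartic_ind4 h : quartic (fun i j k _ => h i j k) = 0.
Proof.
rewrite /quartic big1 // => i _; rewrite big1 // => j _; rewrite big1 // => k _.
rewrite (eq_bigr (fun l => c l * (c i * c j * c k * h i j k))); last by move=> l _; ring.
by rewrite -mulr_suml sum_c mul0r.
Qed.

Lemma quartic_ind3 h : quartic (fun i j _ l => h i j l) = 0.
Proof. by rewrite -quarticC34 quartic_ind4. Qed.

Lemma quartic_ind2 h : quartic (fun i _ k l => h i k l) = 0.
Proof. by rewrite -quarticC23 quartic_ind3. Qed.

Lemma quartic_ind1 h : quartic (fun _ j k l => h j k l) = 0.
Proof. by rewrite -quarticC12 quartic_ind2. Qed.

Variable f : {perm T} -> R.
Local Notation dtr := (dtr f).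
Local Notation four := (four f).
Local Notation corr := (corr f).

Lemma dtr_rev i j k : dtr k j j i = dtr i j j k.
Proof. by rewrite dtrC dtrCl dtrCr. Qed.

Lemma dtr_swapl i j k : i != j -> i != k -> j != k -> dtr j i i k = dtr i j j k.
Proof.
by move=> ij ik jk; rewrite dtr_rev (dtr_rot f ij) // (dtr_rot f jk) // eq_sym.
Qed.

Lemma dtr_swapr i j k : i != j -> i != k -> j != k -> dtr i k k j = dtr i j j k.
Proof. by move=> ij ik jk; rewrite (dtr_rot f ij) // dtr_rev. Qed.

Lemma uniq4P (i j k l : T) : reflect
  [/\ i != j, i != k, i != l & [/\ j != k, j != l & k != l]] (uniq [:: i; j; k; l]).
Proof.
rewrite /= !inE !negb_or -!andbA andbT.
apply: (iffP idP) => [/and5P[-> -> -> -> /andP[-> ->]]|] //.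
by case=> -> -> -> [-> -> ->].
Qed.

(** The three adjacent exchanges generate the full symmetry of [four], which is less visible than
    that of Q because each 3-cycle term is written with a chosen middle point. *)
Lemma fourC12 i j k l : four j i k l = four i j k l.
Proof.
rewrite /four; have -> : uniq [:: j; i; k; l] = uniq [:: i; j; k; l].
  by apply: perm_uniq; rewrite (perm_catCA [:: j] [:: i]).
case: ifP => // /uniq4P[ij ik il [jk jl kl]].
rewrite (dtrCl f j i k l) (dtrC f j k i l) (dtrC f j l i k).
by rewrite (@dtr_swapl i j k) // (@dtr_swapl i j l) //; ring.
Qed.

Lemma fourC23 i j k l : four i k j l = four i j k l.
Proof.
rewrite /four; have -> : uniq [:: i; k; j; l] = uniq [:: i; j; k; l].
  by apply: perm_uniq; rewrite perm_cons (perm_catCA [:: k] [:: j]).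
case: ifP => // /uniq4P[ij ik il [jk jl kl]].
rewrite (dtrCr f i l k j).
by rewrite (@dtr_swapr i j k) // (@dtr_swapl j k l) //; ring.
Qed.

Lemma fourC34 i j k l : four i j l k = four i j k l.
Proof.
rewrite /four; have -> : uniq [:: i; j; l; k] = uniq [:: i; j; k; l].
  by apply: perm_uniq; rewrite !perm_cons (perm_catCA [:: l] [:: k]).
case: ifP => // /uniq4P[ij ik il [jk jl kl]].
rewrite (dtrCr f i j l k) (dtrCr f i l j k) (dtrCr f i k j l).
by rewrite (@dtr_swapr i k l) // (@dtr_swapr j k l) //; ring.
Qed.

Lemma four_head i j k l : four i j k l = four l i j k.
Proof. by rewrite -fourC34 -fourC23 -fourC12. Qed.

Lemma four_eq23 i j k : four i j j k = 0.
Proof. by rewrite /four /= !inE eqxx /= andbF. Qed.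

Lemma four_eq12 i j k : four i i j k = 0.
Proof. by rewrite /four /= !inE eqxx. Qed.

Lemma four_eq13 i j k : four i j i k = 0.
Proof. by rewrite -fourC23 four_eq12. Qed.

Lemma four_eq24 i j k : four i j k j = 0.
Proof. by rewrite -fourC34 four_eq23. Qed.

Lemma four_eq34 i j k : four i j k k = 0.
Proof. by rewrite -fourC23 four_eq24. Qed.

Lemma four_eq14 i j k : four i j k i = 0.
Proof. by rewrite -fourC34 four_eq13. Qed.

Definition four_eq := (four_eq12, four_eq13, four_eq14, four_eq23, four_eq24, four_eq34).

(** Under [quartic], the term [dtr] yields the square in [quartic_four], and each correction yields
    - N F. The corrections cancel the single transpositions that [dtr] produces when i = j or k =
    l. *)
Definition pairing i j k l : R :=
  dtr i j k l - (i == j)%:R * corr (tperm k l) - (k == l)%:R * corr (tperm i j).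

(* The degenerate values make [pairing_sum] hold for coinciding indices too. *)
Definition triple i j k : R :=
  if uniq [:: i; j; k] then dtr i j j k - corr 1%g / 4
  else if (i == j) && (j == k) then - (3 / 4 * corr 1%g) else corr 1%g / 4.

(** For distinct indices this is the definition of [four], with the term [corr 1] spread evenly over
    the four triples; hence the quarter in [triple]. *)
Lemma pairing_sum i j k l :
  pairing i j k l + pairing i k j l + pairing i l j k
  = 2^-1 * four i j k l
    + (triple i j k + triple i j l + triple i k l + triple j k l).
Proof.
have dtr1r a b d : dtr a b d d = corr (tperm a b) by rewrite dtrC dtr1.
have dtr2' a b : dtr a b b a = corr 1%g by rewrite dtrCr dtr2.
have dtr3 a b d : dtr a b a d = dtr b a a d by rewrite dtrCl.
have dtr4 a b d : dtr a b d a = dtr b a a d by rewrite dtrCl dtrCr.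
have dtr5 a b d : dtr a b d b = dtr a b b d by rewrite dtrCr.
pose E := (four_eq, dtr1, dtr1r, dtr2, dtr2', dtr3, dtr4, dtr5, tperm1).
have dtr_sym a b d : a != b -> a != d -> b != d ->
    [/\ dtr b a a d = dtr a b b d, dtr a d d b = dtr a b b d, dtr d b b a = dtr a b b d,
        dtr d a a b = dtr a b b d & dtr b d d a = dtr a b b d].
  move=> ab ad bd; have S1 := dtr_swapl ab ad bd; have S2 := dtr_swapr ab ad bd.
  by rewrite (dtr_rev a b) (dtr_rev b a) (dtr_rev a d) S1 S2.
(* Each pattern of coincidences among the indices leaves a linear identity between values of [corr];
   only the last case has four distinct points. *)
rewrite /triple /pairing /= !inE.
case: (eqVneq i j) => [<-|ij].
  case: (eqVneq i k) => [<-|ik].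
    by case: (eqVneq i l) => [<-|il]; rewrite /= ?E; field.
  case: (eqVneq i l) => [<-|il]; rewrite /= ?E.
    by rewrite eq_sym (negPf ik) /=; field.
  case: (eqVneq k l) => [<-|kl]; rewrite /= ?E; first by field.
  by have [] := dtr_sym i k l ik il kl; lra.
case: (eqVneq i k) => [<-|ik].
  case: (eqVneq i l) => [<-|il]; rewrite /= ?E ?(eq_sym j i) ?(negPf ij) /= ?E; first by field.
  case: (eqVneq j l) => [<-|jl]; rewrite /= ?E; first by field.
  by have [] := dtr_sym i j l ij il jl; lra.
case: (eqVneq i l) => [<-|il].
  case: (eqVneq j k) => [<-|jk]; rewrite /= ?E ?(eq_sym j i) ?(negPf ij) ?(eq_sym k i) ?(negPf ik) /= ?E.
    by field.
  by have [] := dtr_sym i j k ij ik jk; lra.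
case: (eqVneq j k) => [<-|jk].
  case: (eqVneq j l) => [<-|jl]; rewrite /= ?E; first by field.
  by have [] := dtr_sym i j l ij il jl; lra.
case: (eqVneq j l) => [<-|jl].
  rewrite /= ?E ?(eq_sym k j) ?(negPf jk) /=.
  by have [] := dtr_sym i j k ij ik jk; lra.
case: (eqVneq k l) => [<-|kl]; rewrite /= ?E.
  by have [] := dtr_sym i j k ij ik jk; lra.
rewrite /four; have -> : uniq [:: i; j; k; l] by apply/uniq4P.
by field.
Qed.

Lemma quartic_four :
  quartic four = 6 * (\sum_t (\sum_i \sum_j c i * c j * f (t * tperm i j)%g) ^+ 2)
    - 12 * (\sum_i c i ^+ 2) * \sum_i \sum_j c i * c j * corr (tperm i j).
Proof.
(* Renaming indices shows that the three pairings contribute equally; the [triple] terms vanish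
   under [quartic]. *)
have sum_pairing : 3 * quartic pairing = 2^-1 * quartic four.
  transitivity (quartic (fun i j k l =>
    pairing i j k l + pairing i k j l + pairing i l j k)).
    rewrite (quarticD (fun i j k l => _ + _)) (quarticD pairing).
    rewrite -(quarticC34 (fun i j k l => pairing i l j k)).
    by rewrite !(quarticC23 pairing); ring.
  rewrite (eq_quartic pairing_sum) !quarticD quarticZ.
  by rewrite quartic_ind4 quartic_ind3 quartic_ind2 quartic_ind1 !addr0.
suff: quartic pairing
    = \sum_t (\sum_i \sum_j c i * c j * f (t * tperm i j)%g) ^+ 2
      - 2 * (\sum_i c i ^+ 2) * \sum_i \sum_j c i * c j * corr (tperm i j).
  by move: sum_pairing; lra.
have diag : quartic (fun i j k l => (i == j)%:R * corr (tperm k l))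
    = (\sum_i c i ^+ 2) * \sum_i \sum_j c i * c j * corr (tperm i j).
  rewrite /quartic mulr_suml; apply: eq_bigr => i _.
  rewrite (bigD1 i) //= [X in _ + X]big1 => [|j /negPf ji]; last first.
    by rewrite big1 // => k _; rewrite big1 // => l _; rewrite eq_sym ji mul0r mulr0.
  rewrite addr0 mulr_sumr; apply: eq_bigr => k _; rewrite mulr_sumr.
  by apply: eq_bigr => l _; rewrite eqxx mul1r; ring.
rewrite /pairing (_ : quartic _ = quartic dtr
    + (-1) * quartic (fun i j k l => (i == j)%:R * corr (tperm k l))
    + (-1) * quartic (fun i j k l => (k == l)%:R * corr (tperm i j))); last first.
  by rewrite -!quarticZ -!quarticD; apply: eq_quartic => i j k l; ring.
(* Four adjacent exchanges swap the pairs (i,j) and (k,l), so both corrections reduce to [diag]. *)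
rewrite -[quartic (fun i j k l => (k == l)%:R * _)]quarticC23.
rewrite -[quartic (fun i j k l => (j == l)%:R * _)]quarticC12.
rewrite -[quartic (fun i j k l => (i == l)%:R * _)]quarticC34.
rewrite -[quartic (fun i j k l => (i == k)%:R * _)]quarticC23.
rewrite diag.
suff -> : quartic dtr = \sum_t (\sum_i \sum_j c i * c j * f (t * tperm i j)%g) ^+ 2.
  by ring.
under [RHS]eq_bigr do rewrite pair_big.
rewrite (corr_sqr f _ (fun p => c p.1 * c p.2) (fun p => tperm p.1 p.2)).
rewrite /quartic pair_big; apply: eq_bigr => -[i j] _ /=.
rewrite pair_big; apply: eq_bigr => -[k l] _ /=.
by rewrite tpermV /dtr; ring.
Qed.

End Quartic.

Lemma octopus (R : realFieldType) (T : finType) (c : T -> R) (o : T) (f : {perm T} -> R) :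
  \sum_i c i = 0 -> (forall i, i != o -> 0 <= c i) ->
  0 <= \sum_i \sum_j c i * c j * corr f (tperm i j).
Proof.
move=> sum_c c_ge0; set F := \sum_i _.
(* The bound on N F from [quartic_four] can be divided by N only if N > 0; for N = 0 all
   coefficients vanish. *)
have [N0|N_neq0] := eqVneq (\sum_i c i ^+ 2) 0.
  have c0 i : c i = 0.
    apply/eqP; rewrite -sqrf_eq0; apply/eqP.
    by apply: (psumr_eq0P _ N0) => // j _; apply: sqr_ge0.
  by rewrite /F big1 // => i _; rewrite big1 // => j _; rewrite c0 !mul0r.
have N_gt0 : 0 < \sum_i c i ^+ 2.
  by rewrite lt_def N_neq0; apply: sumr_ge0 => i _; apply: sqr_ge0.
have sq_ge0 : 0 <= \sum_t (\sum_i \sum_j c i * c j * f (t * tperm i j)%g) ^+ 2.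
  by apply: sumr_ge0 => t _; apply: sqr_ge0.
suff four_le0 : quartic c (four f) <= 0.
  rewrite -(pmulr_rge0 _ N_gt0).
  by move: four_le0; rewrite (quartic_four sum_c) -mulrA -/F; lra.
(* Each subtracted term omits one of the four indices, so replacing [four] by W does not change the
   form. *)
pose W i j k l := four f i j k l + (-1) * (four f o i j k + four f o i j l
  + four f o i k l + four f o j k l).
have -> : quartic c (four f) = quartic c W.
  rewrite quarticD quarticZ !quarticD.
  rewrite (quartic_ind4 sum_c (four f o)) (quartic_ind3 sum_c (four f o)).
  by rewrite (quartic_ind2 sum_c (four f o)) (quartic_ind1 sum_c (four f o)); ring.
have W_le0 i j k l : i != o -> j != o -> k != o -> l != o -> W i j k l <= 0.
  move=> io jo ko lo; rewrite /W.
  have [u|/negPf nu] := boolP (uniq [:: i; j; k; l]).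
    have /five_ge0 : uniq [:: i; j; k; l; o].
      rewrite -[[:: i; j; k; l; o]]/([:: i; j; k; l] ++ [:: o]) cat_uniq u /= !inE.
      by rewrite orbF andbT !negb_or !(eq_sym o) io jo ko lo.
    by move=> /(_ R f); lra.
  rewrite {1}/four nu.
  have := four_ge0 f o i j k; have := four_ge0 f o i j l.
  by have := four_ge0 f o i k l; have := four_ge0 f o j k l; lra.
(* If one index is o, the subtracted term omitting it equals the leading term, and the other three
   contain o twice. *)
have W0 i j k l : (i == o) || (j == o) || (k == o) || (l == o) -> W i j k l = 0.
  case/orP=> [/orP[/orP[]|]|] /eqP ->; rewrite /W !(@four_eq R T f).
  - ring.
  - rewrite fourC12; ring.
  - rewrite -fourC23 -fourC12; ring.
  - rewrite four_head; ring.
(* Only indices different from o survive, and there all coefficients are nonnegative. *)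
apply: sumr_le0 => i _; apply: sumr_le0 => j _.
apply: sumr_le0 => k _; apply: sumr_le0 => l _.
have [/W0 ->|] := boolP ((i == o) || (j == o) || (k == o) || (l == o)).
  by rewrite mulr0.
rewrite !negb_or => /andP[/andP[/andP[io jo] ko] lo].
by apply: mulr_ge0_le0 (W_le0 _ _ _ _ io jo ko lo); rewrite !mulr_ge0 ?c_ge0.
Qed.

(** * Dirichlet forms of the lazy walk *)

Section Dirichlet.
Variables (R : realFieldType) (T : finType) (f : {perm T} -> R).

Definition dirichlet (i j : T) : R := corr f 1%g - corr f (tperm i j).

Lemma dirichletC i j : dirichlet i j = dirichlet j i.
Proof. by rewrite /dirichlet tpermC. Qed.

Lemma dirichletxx i : dirichlet i i = 0.
Proof. by rewrite /dirichlet tperm1 subrr. Qed.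

Lemma dirichlet_ge0 i j : 0 <= dirichlet i j.
Proof.
suff -> : dirichlet i j = 2^-1 * \sum_t (f t - f (t * tperm i j)%g) ^+ 2.
  by apply: mulr_ge0; rewrite ?invr_ge0 //; apply: sumr_ge0 => t _; apply: sqr_ge0.
have -> : \sum_t (f t - f (t * tperm i j)%g) ^+ 2 = \sum_t f t ^+ 2
    + \sum_t f (t * tperm i j)%g ^+ 2 - 2 * corr f (tperm i j).
  rewrite /corr mulr_sumr -sumrN -!big_split.
  by apply: eq_bigr => t _ /=; ring.
have -> : \sum_t f (t * tperm i j)%g ^+ 2 = \sum_t f t ^+ 2.
  by rewrite [RHS](reindex_inj (mulIg (tperm i j))).
have -> : \sum_t f t ^+ 2 = corr f 1%g.
  by apply: eq_bigr => t _; rewrite mulg1.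
by rewrite /dirichlet; field.
Qed.

(** Apply [octopus] to p minus the unit mass at i, which can be negative only at i. As its sum is 0,
    [corr] may be replaced by minus [dirichlet]; the two cross terms give the factor 2, and the term
    at (i, i) is 0. *)
Lemma octopus_dirichlet (p : T -> R) (i : T) : (forall j, 0 <= p j) -> \sum_j p j = 1 ->
  \sum_j \sum_k p j * p k * dirichlet j k <= 2 * \sum_k p k * dirichlet i k.
Proof.
move=> p_ge0 p1; pose c j := p j - (j == i)%:R.
have delta_sum (g : T -> R) : \sum_j (j == i)%:R * g j = g i.
  rewrite (bigD1 i) //= eqxx mul1r big1 ?addr0 // => j /negPf ->; exact: mul0r.
have c0 : \sum_j c j = 0.
  rewrite /c sumrB p1; have := delta_sum (fun=> 1).
  by under eq_bigr do rewrite mulr1; move=> ->; rewrite subrr.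
have /(octopus f c0) : forall j, j != i -> 0 <= c j.
  by move=> j /negPf ji; rewrite /c ji subr0.
have -> : \sum_j \sum_k c j * c k * corr f (tperm j k)
    = - \sum_j \sum_k c j * c k * dirichlet j k.
  apply/eqP; rewrite -subr_eq0 opprK -big_split /=; apply/eqP.
  rewrite (eq_bigr (fun j => c j * ((\sum_k c k) * corr f 1%g))); last first.
    move=> j _; rewrite -big_split mulr_suml mulr_sumr; apply: eq_bigr => k _ /=.
    by rewrite /dirichlet; ring.
  by rewrite c0 -mulr_suml c0 mul0r.
have -> : \sum_j \sum_k c j * c k * dirichlet j k
    = \sum_j \sum_k p j * p k * dirichlet j k
      - 2 * \sum_k p k * dirichlet i k.
  transitivity (\sum_j ((\sum_k p j * p k * dirichlet j k) - p j * dirichlet j i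
      - (j == i)%:R * ((\sum_k p k * dirichlet j k) - dirichlet j i))).
    apply: eq_bigr => j _; rewrite -(delta_sum (dirichlet j)).
    rewrite !mulrBr !mulr_sumr -!sumrB; apply: eq_bigr => k _.
    by rewrite /c; ring.
  rewrite !sumrB delta_sum dirichletxx subr0.
  rewrite (eq_bigr (fun k => p k * dirichlet i k) (F1 := fun j => p j * dirichlet j i)).
    by ring.
  by move=> j _; rewrite dirichletC.
by lra.
Qed.

End Dirichlet.

Lemma sum_sym_offdiag (R : realFieldType) (n : nat) (g : 'I_n -> 'I_n -> R) :
  (forall i j, g i j = g j i) -> (forall i, g i i = 0) ->
  \sum_i \sum_j g i j = 2 * \sum_(i < n) \sum_(j < n | (i < j)%N) g i j.
Proof.
move=> gC g0.
have -> : \sum_i \sum_j g i j = \sum_(i < n) \sum_(j < n | (i < j)%N) g i j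
    + \sum_(i < n) \sum_(j < n | (j < i)%N) g i j.
  rewrite -big_split; apply: eq_bigr => i _ /=.
  rewrite (bigID (fun j : 'I_n => (i < j)%N)) /=; congr (_ + _).
  under eq_bigl do rewrite -leqNgt leq_eqVlt.
  rewrite (bigD1 i) ?eqxx //= g0 add0r; apply: eq_bigl => j.
  by rewrite -val_eqE /=; case: ltngtP.
rewrite [X in _ + X](exchange_big_dep predT) //=.
under [X in _ + X]eq_bigr => i _ do under eq_bigr do rewrite gC.
by rewrite mulr_natl mulr2n.
Qed.

(** * Energy of the walk along powers of two, and mixing *)

Section Walk.
Variables (R : realType) (n : nat) (w : 'I_n -> 'I_n -> R).
Hypothesis hw : weight_function w.

Local Notation p := (trans_prob w).
Local Notation deg := (wdeg w).

Lemma trans_probD s t i j : p (s + t) i j = \sum_k p s i k * p t k j.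
Proof. by rewrite /trans_prob exprD mxE. Qed.

Lemma trans_prob1 i j : p 1 i j = if i == j then 2^-1 else w i j / (2 * deg i).
Proof. by rewrite /trans_prob expr1 mxE. Qed.

Lemma trans_prob0 i j : p 0 i j = (i == j)%:R.
Proof. by rewrite /trans_prob expr0 mxE. Qed.

Lemma trans_prob_ge0 t i j : 0 <= p t i j.
Proof.
case: hw => _ w_ge0 deg_gt0.
elim: t i j => [|t IHt] i j; first by rewrite trans_prob0 ler0n.
rewrite -add1n trans_probD; apply: sumr_ge0 => k _; apply: mulr_ge0 => //.
rewrite trans_prob1; case: eqVneq => [_|ik]; first by rewrite invr_ge0.
by rewrite divr_ge0 ?w_ge0 // mulr_ge0 // ltW.
Qed.

Lemma trans_prob_sum t i : \sum_j p t i j = 1.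
Proof.
case: hw => _ _ deg_gt0.
elim: t i => [|t IHt] i.
  rewrite (bigD1 i) //= trans_prob0 eqxx big1 ?addr0 // => j /negPf ji.
  by rewrite trans_prob0 eq_sym ji.
under eq_bigr do rewrite -add1n trans_probD.
rewrite exchange_big /=; under eq_bigr do rewrite -mulr_sumr IHt mulr1.
rewrite (bigD1 i) //= trans_prob1 eqxx.
under eq_bigr => j /negPf ji do rewrite trans_prob1 eq_sym ji.
rewrite -mulr_suml -/(deg i).
by field; rewrite gt_eqF.
Qed.

Lemma trans_prob_rev t i j : deg i * p t i j = deg j * p t j i.
Proof.
case: hw => wC _ deg_gt0.
elim: t i j => [|t IHt] i j.
  by rewrite !trans_prob0 eq_sym; case: eqVneq => [->|] //; rewrite !mulr0.
have rev1 a b : deg a * p 1 a b = deg b * p 1 b a.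
  rewrite !trans_prob1 eq_sym; case: eqVneq => [->|ab] //.
  by rewrite (wC b a ab); field; rewrite !gt_eqF.
rewrite -[t.+1 in LHS]add1n -[t.+1]addn1 !trans_probD !mulr_sumr; apply: eq_bigr => k _.
by rewrite mulrA rev1 mulrAC IHt mulrA.
Qed.

Variable f : 'S_n -> R.

Definition energy (t : nat) : R := \sum_i \sum_j deg i * p t i j * dirichlet f i j.

(** Reversibility lets a path of length 2t start from its midpoint i, with both ends distributed as
    p_t(i, .). Then [octopus_dirichlet] applies for each i separately. *)
Lemma energy_double t : energy (t + t) <= 2 * energy t.
Proof.
have [_ _ deg_gt0] := hw.
have -> : energy (t + t)
    = \sum_i deg i * \sum_j \sum_k p t i j * p t i k * dirichlet f j k.
  transitivity (\sum_j \sum_k \sum_i deg i * (p t i j * p t i k * dirichlet f j k)).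
    apply: eq_bigr => j _; apply: eq_bigr => k _.
    rewrite trans_probD mulr_sumr mulr_suml; apply: eq_bigr => i _.
    by rewrite !mulrA trans_prob_rev.
  rewrite (eq_bigr _ (fun j _ => exchange_big _ _ _ _ _ _)) exchange_big /=.
  by apply: eq_bigr => i _; rewrite mulr_sumr; apply: eq_bigr => j _; rewrite mulr_sumr.
rewrite /energy mulr_sumr; apply: ler_sum => i _.
under [X in _ <= _ * X]eq_bigr do rewrite -mulrA.
rewrite -mulr_sumr mulrCA ler_pM2l //.
apply: octopus_dirichlet; [exact: trans_prob_ge0 | exact: trans_prob_sum].
Qed.

Lemma energy_exp2 k : energy (2 ^ k) <= 2 ^+ k * energy 1.
Proof.
elim: k => [|k IHk]; first by rewrite mul1r.
rewrite expnS mul2n -addnn exprS -mulrA.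
by apply: le_trans (energy_double _) _; rewrite ler_pM2l.
Qed.

(** The factor 1/2 from laziness cancels the double counting of unordered pairs. *)
Lemma energy1 : energy 1 = \sum_(i < n) \sum_(j < n | (i < j)%N) w i j * dirichlet f i j.
Proof.
have [wC _ deg_gt0] := hw.
rewrite /energy sum_sym_offdiag; last 2 first.
- by move=> i j; rewrite trans_prob_rev dirichletC.
- by move=> i; rewrite dirichletxx mulr0.
rewrite mulr_sumr; apply: eq_bigr => i _; rewrite mulr_sumr.
apply: eq_bigr => j ij; rewrite trans_prob1 ifN; last first.
  by apply: contraTneq ij => ->; rewrite ltnn.
by field; rewrite gt_eqF.
Qed.

(** After the first t - s steps, p_t(i, j) is an average of values p_s(k, j), so a lower bound
    uniform in k persists. *)
Lemma mixed_lower s t i j : (s <= t)%N -> mixed w s -> 3 / 4 * stationary w j <= p t i j.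
Proof.
move=> /subnK <- /forallP mix.
set m := 3 / 4 * _; rewrite trans_probD -[m]mul1r -(trans_prob_sum (t - s) i) mulr_suml.
apply: ler_sum => k _; apply: ler_wpM2l; first exact: trans_prob_ge0.
by have /forallP/(_ j)/ltW := mix k.
Qed.

Lemma min_wdeg_sq_le i j : min_wdeg_sq w <= deg i * deg j.
Proof.
have [_ _ deg_gt0] := hw.
have minP a : min_wdeg_sq w <= deg a ^+ 2 by exact: bigmin_le_cond.
have [ij|ji] := leP (deg i) (deg j).
  by apply: le_trans (minP i) _; rewrite expr2 ler_pM2l.
by apply: le_trans (minP j) _; rewrite expr2 ler_pM2r // ltW.
Qed.

Lemma wtot_ge0 : 0 <= wtot w.
Proof. by have [_ _ deg_gt0] := hw; apply: sumr_ge0 => i _; apply: ltW. Qed.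

Lemma mixed_energy_ge s t : (s <= t)%N -> mixed w s ->
  3 / 2 * (min_wdeg_sq w / wtot w)
    * \sum_(i < n) \sum_(j < n | (i < j)%N) dirichlet f i j <= energy t.
Proof.
have [_ _ deg_gt0] := hw.
move=> st mix; set m := min_wdeg_sq w / wtot w.
(* The 3/4 is the mixing threshold; the 2 passes from unordered to ordered pairs. *)
rewrite (_ : 3 / 2 * m = 2 * (3 / 4 * m)); last by field.
rewrite mulrAC -sum_sym_offdiag; [|exact: dirichletC|exact: dirichletxx].
rewrite mulrC mulr_sumr; apply: ler_sum => i _; rewrite mulr_sumr.
apply: ler_sum => j _; apply: ler_wpM2r; first exact: dirichlet_ge0.
apply: (@le_trans _ _ (deg i * (3 / 4 * stationary w j))).
  rewrite [leRHS]mulrCA ler_pM2l ?divr_gt0 // /m /stationary mulrA.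
  by apply: ler_wpM2r (min_wdeg_sq_le i j); rewrite invr_ge0 wtot_ge0.
by rewrite ler_pM2l // (mixed_lower _ _ st).
Qed.

Lemma delta_le1 d : (0 < n)%N -> delta w d <= 1.
Proof.
move=> n_gt0; rewrite /delta.
have max_ge1 t : 1 <= max_return w t.
  apply: le_trans (le_bigmax _ _ (Ordinal n_gt0)).
  by rewrite lerDl trans_prob_ge0.
suff prod_ge1 : 1 <= \prod_(0 <= k < (trunc_log 2 d).+1) max_return w (2 ^ k).
  by rewrite invf_le1 // (lt_le_trans ltr01).
by elim/big_ind: _ => // x y x1 y1; rewrite -[1]mulr1 ler_pM.
Qed.

Lemma mix_coef_le : (0 < n)%N ->
  mix_coef w (3 / 4) * \sum_(i < n) \sum_(j < n | (i < j)%N) dirichlet f i j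
  <= \sum_(i < n) \sum_(j < n | (i < j)%N) w i j * dirichlet f i j.
Proof.
move=> n_gt0; have [_ w_ge0 _] := hw.
set K := \sum_(i < n) _; set E := leRHS.
have K_ge0 : 0 <= K by do 2 apply: sumr_ge0 => ? _; exact: dirichlet_ge0.
have E_ge0 : 0 <= E.
  apply: sumr_ge0 => i _; apply: sumr_ge0 => j ij; rewrite mulr_ge0 ?dirichlet_ge0 //.
  by apply: w_ge0; apply: contraTneq ij => ->; rewrite ltnn.
rewrite /mix_coef /dmix; case: pselect => [ex_t|_]; last by rewrite mul0r.
(* At mixing time 0 the coefficient is 0, since division by 0 yields 0. *)
case: ex_minnP => [[|d]] mix _; first by rewrite invr0 mulr0 !mul0r.
set D := d.+1; set m := min_wdeg_sq w / wtot w.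
have m_ge0 : 0 <= m.
  apply: divr_ge0 wtot_ge0; apply: le_bigmin => [|i _]; exact: sqr_ge0.
(* The power of two with exponent [(trunc_log 2 D).+1] exceeds D, so the walk is mixed by then, and
   is at most 2 D, which bounds the loss in [energy_exp2]. *)
have /andP[le_log lt_log] := trunc_log_bounds (isT : (1 < 2)%N) (isT : (0 < D)%N).
have := mixed_energy_ge (ltnW lt_log) mix; rewrite -/m -/K => le1.
have := le_trans le1 (energy_exp2 _); rewrite energy1 -/E => le2.
have D_gt0 : (0 : R) < D%:R by rewrite ltr0n.
have le3 : 2 ^+ (trunc_log 2 D).+1 * E <= 2 * D%:R * E.
  by rewrite ler_wpM2r // exprS ler_pM2l // -natrX ler_nat.
(* Halving the constant 3/2 of [mixed_energy_ge] against 2 D leaves the final constant 3/4. *)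
have le4 : 3 / 4 * m * K <= D%:R * E by have := le_trans le2 le3; lra.
have del1 : delta w D <= 1 := delta_le1 D n_gt0.
rewrite -(ler_pM2l D_gt0); apply: le_trans le4.
rewrite (_ : D%:R * _ = delta w D * (3 / 4 * m * K)); last by field; rewrite gt_eqF.
apply: ler_piMl => //; apply: mulr_ge0 K_ge0.
by apply: mulr_ge0 => //; apply: divr_ge0.
Qed.

End Walk.

(** * Reduction from complex to real functions *)

Local Open Scope complex_scope.

Lemma sum_complex (R : rcfType) (I : Type) (r : seq I) (P : pred I) (a b : I -> R) :
  \sum_(i <- r | P i) (a i +i* b i) = (\sum_(i <- r | P i) a i) +i* (\sum_(i <- r | P i) b i).
Proof. elim/big_rec3: _ => [|i x y z _ ->]; reflexivity. Qed.

Section QuadraticForm.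
Variables (R : realType) (n : nat) (f : {ffun 'S_n -> R[i]}).

Definition gform (A : {ffun 'S_n -> R[i]}) : R[i] := L2_dot (gact A f) f.

Lemma gformE A :
  gform A = \sum_tau \sum_sigma A sigma * (f (tau * sigma)%g * Num.conj (f tau)).
Proof.
apply: eq_bigr => tau _; rewrite ffunE mulr_suml.
by apply: eq_bigr => sigma _; rewrite mulrA.
Qed.

Lemma gformD A B : gform (A + B) = gform A + gform B.
Proof.
rewrite !gformE -big_split; apply: eq_bigr => tau _ /=.
by rewrite -big_split; apply: eq_bigr => sigma _ /=; rewrite ffunE mulrDl.
Qed.

Lemma gformZ z A : gform (z *: A) = z * gform A.
Proof.
rewrite !gformE mulr_sumr; apply: eq_bigr => tau _.
rewrite mulr_sumr; apply: eq_bigr => sigma _; rewrite ffunE.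
exact/esym/mulrA.
Qed.

Lemma gform_sum I (r : seq I) (P : pred I) (A : I -> {ffun 'S_n -> R[i]}) :
  gform (\sum_(i <- r | P i) A i) = \sum_(i <- r | P i) gform (A i).
Proof.
apply: (big_morph gform gformD).
by rewrite -[0](scale0r (0 : {ffun 'S_n -> R[i]})) gformZ mul0r.
Qed.

Lemma gform_galg_of s : gform (galg_of R s) = \sum_tau f (tau * s)%g * Num.conj (f tau).
Proof.
rewrite gformE; apply: eq_bigr => tau _.
rewrite (bigD1 s) //= ffunE eqxx mul1r big1 ?addr0 // => t /negPf ts.
by rewrite ffunE ts mul0r.
Qed.

Definition real_part tau : R := complex.Re (f tau).
Definition imag_part tau : R := complex.Im (f tau).

Lemma gform_nabla i j : gform (nabla R i j)
  = (dirichlet real_part i j + dirichlet imag_part i j)%:C.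
Proof.
have galg_invol s : (s * s = 1)%g ->
    gform (galg_of R s) = (corr real_part s + corr imag_part s)%:C.
  move=> ss; rewrite gform_galg_of.
  transitivity (\sum_tau (real_part tau * real_part (tau * s)%g
      + imag_part tau * imag_part (tau * s)%g)
      +i* (imag_part (tau * s)%g * real_part tau - real_part (tau * s)%g * imag_part tau)).
    apply: eq_bigr => tau _; rewrite /real_part /imag_part.
    case: (f (tau * s)%g) (f tau) => [a b] [c d] /=.
    by apply/eqP; rewrite eq_complex /=; apply/andP; split; apply/eqP; ring.
  rewrite sum_complex big_split /=; congr (_ +i* _).
  (* The imaginary part cancels: as s is an involution, the substitution tau -> tau s exchanges the
     two sums. *)
  rewrite sumrB; apply/eqP; rewrite subr_eq0; apply/eqP.
  rewrite (reindex_inj (mulIg s)) /=; apply: eq_bigr => tau _.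
  by rewrite -mulgA ss mulg1 mulrC.
rewrite /nabla -scaleN1r gformD gformZ !galg_invol ?mulg1 ?tperm2 //.
by rewrite mulN1r -rmorphN -rmorphD /dirichlet; congr (_%:C); ring.
Qed.

Lemma gform_sub_scaled_DeltaK (w : 'I_n -> 'I_n -> R) (a : R) :
  L2_dot (gact (Delta w) f - gact (a%:C *: DeltaK) f) f
  = (\sum_(i < n) \sum_(j < n | (i < j)%N)
      w i j * (dirichlet real_part i j + dirichlet imag_part i j)
    - a * \sum_(i < n) \sum_(j < n | (i < j)%N)
      (dirichlet real_part i j + dirichlet imag_part i j))%:C.
Proof.
transitivity (gform (Delta w) - gform (a%:C *: DeltaK)).
  rewrite /gform /L2_dot -sumrB; apply: eq_bigr => tau _.
  by rewrite !ffunE mulrBl.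
rewrite gformZ /Delta /DeltaK !gform_sum rmorphB rmorphM !rmorph_sum.
congr (_ - _ * _); apply: eq_bigr => i _; rewrite gform_sum rmorph_sum;
  apply: eq_bigr => j _; last exact: gform_nabla.
by rewrite gformZ gform_nabla rmorphM.
Qed.

End QuadraticForm.

Theorem theorem2 (R : realType) :
  exists c : R, 0 < c /\
    forall (n : nat) (w : 'I_n -> 'I_n -> R),
      (2 <= n)%N -> weight_function w ->
      op_ge (gact (Delta w)) (gact ((mix_coef w c)%:C *: @DeltaK R n)).
Proof.
exists (3 / 4); split=> [|n w n_ge2 hw f]; first by rewrite divr_gt0.
have n_gt0 := ltnW n_ge2.
rewrite gform_sub_scaled_DeltaK lecR subr_ge0.
under eq_bigr do rewrite big_split.
under [leRHS]eq_bigr do (under eq_bigr do rewrite mulrDr; rewrite big_split).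
(* The inequality separates into the real case for the real part of f and for its imaginary part. *)
rewrite !big_split mulrDr.
by apply: lerD; apply: mix_coef_le.
Qed.
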